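(* Let $\Theta=\{\theta_1,\ldots,\theta_n,\theta_{n+1}\}$ and let $k\ge 2$ experts provide a mass matrix with $k$ rows and $n+1$ columns, whose entry in row $i$ and column $l$ is $m_i(\theta_l)\in[0,1]$, each row summing to $1$ (all other masses being zero). Suppose that for some $1\le j\le n+1$, column $j$ is $(\epsilon_{j_1},\epsilon_{j_2},\ldots,\epsilon_{j_k})'$ (transposed vector) with $0<\epsilon_{j_1},\ldots,\epsilon_{j_k}<1$, and that every column other than column $j$ contains at least one entry equal to zero. Then Dempster's rule of combination (under Shafer's model) applied to $m_1,\ldots,m_k$ gives $m(\theta_j)=1$, while the classical DSm rule (free-DSm model) gives $$m(\theta_j)=\epsilon_{j_1}\cdot\epsilon_{j_2}\cdots\epsilon_{j_k}\neq 0.$$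
   Context: Under Shafer's model, the elements of $\Theta$ are exclusive and exhaustive, and $2^\Theta$ is the set of all subsets of $\Theta$, with $\theta_i$ identified with $\{\theta_i\}$. A basic belief assignment (bba) on $2^\Theta$ is a map $m:2^\Theta\to[0,1]$ with $m(\emptyset)=0$ and $\sum_{A\in 2^\Theta}m(A)=1$. Dempster's rule for $k$ sources: $m(\emptyset)=0$ and, for $B\in 2^\Theta$, $B\ne\emptyset$, $$m(B)=\frac{\sum_{X_1\cap\cdots\cap X_k=B}\prod_{i=1}^k m_i(X_i)}{1-\sum_{X_1\cap\cdots\cap X_k=\emptyset}\prod_{i=1}^k m_i(X_i)},$$ where the sums are over $X_1,\ldots,X_k\in 2^\Theta$. Free-DSm model: the hyper-power set $D^\Theta$ is the free Boolean pre-algebra (free distributive lattice, with $\emptyset$ adjoined) generated by the elements of $\Theta$ with the operations $\cup$ and $\cap$. That is, it contains $\emptyset$ and all $\theta_i$, is closed under $\cup$ and $\cap$, and contains nothing else; no exclusivity between the $\theta_i$ is assumed, and in particular intersections of distinct nonempty sets of generators are distinct nonempty elements. A bba on $D^\Theta$ is a map $m:D^\Theta\to[0,1]$ with $m(\emptyset)=0$ and $\sum_{A\in D^\Theta}m(A)=1$. The classical DSm rule combines bbas $m_1,\ldots,m_k$ on $D^\Theta$ into $$m(A)=\sum_{X_1,\ldots,X_k\in D^\Theta,\ X_1\cap\cdots\cap X_k=A}\ \prod_{i=1}^k m_i(X_i),\qquad m(\emptyset)=0.$$ *)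

(* Defs.v *)
From HB Require Import structures.
From mathcomp Require Import all_boot all_order all_algebra.

Set Implicit Arguments.
Unset Strict Implicit.
Unset Printing Implicit Defensive.

Import Order.TTheory GRing.Theory Num.Theory.

Local Open Scope ring_scope.

Definition is_bba (R : realFieldType) (E : finType) (e : E) (m : E -> R) : Prop :=
  [/\ forall A, 0 <= m A <= 1, m e = 0 & \sum_A m A = 1].

(* When the sources are in total conflict the denominator is 0 and the rule is
   undefined in the literature; here it then returns 0 for every B. *)
Definition dempster (R : realFieldType) (T : finType) (k : nat)
    (m : 'I_k -> {set T} -> R) (B : {set T}) : R :=
  if B == set0 then 0 else
  (\sum_(X : {ffun 'I_k -> {set T}} | \bigcap_(i < k) X i == B)
     \prod_(i < k) m i (X i))
  / (1 - \sum_(X : {ffun 'I_k -> {set T}} | \bigcap_(i < k) X i == set0)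
           \prod_(i < k) m i (X i)).

(* The hyper-power set is realised in the generic Venn diagram of the elements
   of T: a region is the set S of those t : T that contain it, so t itself
   becomes the set of the regions S with t \in S.  No region is excluded, so
   no exclusivity is assumed.  Lemma hyper_free below shows that the lattice
   generated in this way is the free distributive lattice on T with an empty
   element adjoined. *)
Definition venn (T : finType) (t : T) : {set {set T}} :=
  [set S : {set T} | t \in S].

Definition hyper_closed (T : finType) (F : {set {set {set T}}}) : bool :=
  [&& set0 \in F, [forall t, venn t \in F]
    & [forall A in F, forall B in F, (A :|: B \in F) && (A :&: B \in F)]].

Definition hyper_powerset (T : finType) : {set {set {set T}}} :=
  \bigcap_(F | hyper_closed F) F.

Lemma hyper_powerset_closed (T : finType) : hyper_closed (hyper_powerset T).
Proof.
apply/and3P; split.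
- by apply/bigcapP => F /and3P[].
- by apply/forallP => t; apply/bigcapP => F /and3P[_ /forallP].
- apply/forall_inP => A /bigcapP hA; apply/forall_inP => B /bigcapP hB.
  apply/andP; split; apply/bigcapP => F cF; have := cF;
    by case/and3P=> _ _ /forall_inP/(_ _ (hA _ cF))/forall_inP/(_ _ (hB _ cF))/andP[].
Qed.

Record hyper (T : finType) := Hyper {
  hyper_val :> {set {set T}};
  hyper_valP : hyper_val \in hyper_powerset T }.

HB.instance Definition _ (T : finType) := [isSub for @hyper_val T].
HB.instance Definition _ (T : finType) := [Finite of hyper T by <:].

Section Operations.
Variable T : finType.
Implicit Types A B : hyper T.

Fact hyper0_subproof : set0 \in hyper_powerset T.
Proof. by case/and3P: (hyper_powerset_closed T). Qed.

Fact hyper_gen_subproof t : venn t \in hyper_powerset T.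
Proof. by case/and3P: (hyper_powerset_closed T) => _ /forallP. Qed.

Fact hyperU_subproof A B : A :|: B \in hyper_powerset T.
Proof.
case/and3P: (hyper_powerset_closed T) => _ _.
by move/forall_inP/(_ _ (valP A))/forall_inP/(_ _ (valP B))/andP=> [].
Qed.

Fact hyperI_subproof A B : A :&: B \in hyper_powerset T.
Proof.
case/and3P: (hyper_powerset_closed T) => _ _.
by move/forall_inP/(_ _ (valP A))/forall_inP/(_ _ (valP B))/andP=> [].
Qed.

Definition hyper0 : hyper T := Hyper hyper0_subproof.
Definition hyper_gen (t : T) : hyper T := Hyper (hyper_gen_subproof t).
Definition hyperU A B : hyper T := Hyper (hyperU_subproof A B).
Definition hyperI A B : hyper T := Hyper (hyperI_subproof A B).

Lemma hyper_ind_pred (P : pred (hyper T)) :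
  P hyper0 -> (forall t, P (hyper_gen t)) ->
  (forall A B, P A -> P B -> P (hyperU A B)) ->
  (forall A B, P A -> P B -> P (hyperI A B)) ->
  forall A, P A.
Proof.
move=> P0 Pg PU PI A.
have cF : hyper_closed [set hyper_val B | B in P].
  apply/and3P; split.
  - by apply/imsetP; exists hyper0.
  - by apply/forallP => t; apply/imsetP; exists (hyper_gen t) => //; apply: Pg.
  - apply/forall_inP => _ /imsetP[B PB ->].
    apply/forall_inP => _ /imsetP[C PC ->].
    apply/andP; split; apply/imsetP.
    + by exists (hyperU B C) => //; apply: PU.
    + by exists (hyperI B C) => //; apply: PI.
have /bigcapP/(_ _ cF)/imsetP[B PB eAB] := valP A.
by rewrite (val_inj eAB : A = B).
Qed.

Lemma hyper_upset A (S S' : {set T}) : S \subset S' -> S \in (A : {set {set T}}) ->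
  S' \in (A : {set {set T}}).
Proof.
move=> sSS'; apply/implyP; move: A.
apply: hyper_ind_pred => [|t|A B /implyP hA /implyP hB|A B /implyP hA /implyP hB];
  apply/implyP; rewrite ?inE //=.
- exact: (subsetP sSS').
- by case/orP=> [/hA|/hB] ->; rewrite ?orbT.
- by case/andP=> /hA -> /hB ->.
Qed.

End Operations.

Lemma hyper_free (T : finType) (d : Order.disp_t) (L : bDistrLatticeType d)
    (f : T -> L) :
  exists! h : {ffun hyper T -> L},
    [/\ h (hyper0 T) = Order.bottom,
        forall t, h (hyper_gen t) = f t,
        forall A B, h (hyperU A B) = Order.join (h A) (h B)
      & forall A B, h (hyperI A B) = Order.meet (h A) (h B)].
Proof.
pose top : L := (\join_t f t)%O.
pose g (S : {set T}) : L := foldr (fun t x => Order.meet (f t) x) top (enum S).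
have le_g x S : (x <= g S)%O = (x <= top)%O && [forall t in S, (x <= f t)%O].
  have -> : [forall t in S, (x <= f t)%O] = all (fun t => x <= f t)%O (enum S).
    apply/forall_inP/allP => H t; have := H t; rewrite mem_enum; exact.
  rewrite /g; elim: (enum S) => [|t s IH] /=; first by rewrite andbT.
  by rewrite lexI IH andbCA.
have /all_and2[g_top g_f] S : (g S <= top)%O /\ {in S, forall t, (g S <= f t)%O}.
  by have := lexx (g S); rewrite le_g => /andP[? /forall_inP].
pose h (A : hyper T) : L := (\join_(S in hyper_val A) g S)%O.
have hle (A : hyper T) S : S \in hyper_val A -> (g S <= h A)%O.
  by move=> SA; rewrite /h; apply: joins_sup.
have hmono (A B : hyper T) : hyper_val A \subset hyper_val B -> (h A <= h B)%O.
  by move=> sAB; apply/joinsP => S /(subsetP sAB); apply: hle.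
have h0 : h (hyper0 T) = Order.bottom by rewrite /h big1 // => S; rewrite inE.
have hg t : h (hyper_gen t) = f t.
  apply/le_anti/andP; split.
    apply/joinsP => S; rewrite inE; apply: g_f.
  apply: le_trans (hle _ [set t] _); last by rewrite /= !inE.
  have ft_top : (f t <= top)%O by rewrite /top; apply: joins_sup.
  rewrite le_g ft_top /=.
  by apply/forall_inP => u; rewrite inE => /eqP ->.
have hU A B : h (hyperU A B) = Order.join (h A) (h B).
  apply/le_anti/andP; split.
    apply/joinsP => S; rewrite inE => /orP[] /hle SA;
      by rewrite lexU2 // SA ?orbT.
  by rewrite leUx !hmono //= ?subsetUl ?subsetUr.
have hI A B : h (hyperI A B) = Order.meet (h A) (h B).
  apply/le_anti/andP; split.
    by rewrite lexI !hmono //= ?subsetIl ?subsetIr.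
  rewrite {1}/h (big_morph (Order.meet^~ (h B)) (fun x y => meetUl x y _) (meet0x _)).
  apply/joinsP => S SA.
  rewrite {1}/h (big_morph (Order.meet (g S)) (meetUr (g S)) (meetx0 _)).
  apply/joinsP => S' SB.
  apply: le_trans (hle _ (S :|: S') _); last first.
    by rewrite inE (hyper_upset (subsetUl _ _) SA) (hyper_upset (subsetUr _ _) SB).
  rewrite le_g leIxl ?g_top //=; apply/forall_inP => t; rewrite inE => /orP[] tS.
  - by rewrite leIxl // g_f.
  - by rewrite leIxr // g_f.
exists (finfun h); split.
  by split=> *; rewrite !ffunE.
move=> h' [h'0 h'g h'U h'I]; apply/ffunP => A; rewrite ffunE; apply/eqP; move: A.
apply: hyper_ind_pred => [|t|A B /eqP eA /eqP eB|A B /eqP eA /eqP eB].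
- by rewrite h0 h'0.
- by rewrite hg h'g.
- by rewrite hU h'U eA eB.
- by rewrite hI h'I eA eB.
Qed.

(* The intersection is that of the underlying sets of regions, i.e. the iterated
   hyperI; only for k = 0 does it leave the hyper-power set. *)
Definition dsm (R : realFieldType) (T : finType) (k : nat)
    (m : 'I_k -> hyper T -> R) (A : hyper T) : R :=
  if A == hyper0 T then 0 else
  \sum_(X : {ffun 'I_k -> hyper T} | \bigcap_(i < k) (X i : {set {set T}}) == A)
     \prod_(i < k) m i (X i).

(* Main.v *)
Require Import Defs.
From mathcomp Require Import all_boot all_order all_algebra.

Import Order.TTheory GRing.Theory Num.Theory.

Local Open Scope ring_scope.

(* Both rules sum products of masses, and here only one product survives in each
   sum, the one in which every expert chooses the j-th singleton.  Under Shafer's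
   model, nonzero masses sit on singletons, so a nonempty intersection forces a
   common singleton, and a zero in each other column leaves only the j-th; hence
   Dempster's numerator and denominator (the mass of the nonempty intersections)
   coincide.  In the free model, an intersection of generators equal to the j-th
   one contains the region [set j], which lies in no other generator. *)

(** For [X] satisfying [P] and not constantly [a], the second hypothesis forces some factor
    [m i (X i)] to vanish. *)
Lemma sum_prod_const {R : realFieldType} {E : finType} {k : nat}
    (m : 'I_k -> E -> R) (P : pred {ffun 'I_k -> E}) (a : E) :
  P [ffun=> a] ->
  (forall X, P X -> (forall i, m i (X i) != 0) -> forall i, X i = a) ->
  \sum_(X : {ffun 'I_k -> E} | P X) \prod_(i < k) m i (X i) = \prod_(i < k) m i a.
Proof.
move=> Pa ha; rewrite (bigD1 [ffun=> a]) //= [X in _ + X]big1 ?addr0.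
  by apply: eq_bigr => i _; rewrite ffunE.
move=> X /andP[PX /eqP neqX]; apply/eqP/prodf_eq0.
case: (pickP (fun i => m i (X i) == 0)) => [i mi0 | m_neq0]; first by exists i.
case: neqX; apply/ffunP => i; rewrite ffunE.
by apply: ha => // i'; rewrite m_neq0.
Qed.

(** By distributivity the sum is the product over the experts of their total masses. *)
Lemma sum_prod_bba {R : realFieldType} {E : finType} {e : E} {k : nat}
    {m : 'I_k -> E -> R} (hm : forall i, is_bba e (m i)) :
  \sum_(X : {ffun 'I_k -> E}) \prod_(i < k) m i (X i) = 1.
Proof.
by rewrite -bigA_distr_bigA big1 //= => i _; case: (hm i).
Qed.

(** Positivity of [k] matters: the empty intersection is [setT]. *)
Lemma bigcap_const_ord (T : finType) (k : nat) (A : {set T}) :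
  (0 < k)%N -> \bigcap_(i < k) A = A.
Proof.
case: k => // k _; apply/setP => x; apply/bigcapP/idP => [|xA i _ //].
by move=> h; exact: (h ord0 isT).
Qed.

Lemma mass_neq0_gen {R : realFieldType} {L E : finType} {g : L -> E} {m : E -> R} :
  (forall A, (forall l, A <> g l) -> m A = 0) ->
  forall A, m A != 0 -> exists l, A = g l.
Proof.
move=> h0 A; case: (pickP (fun l => A == g l)) => [l /eqP -> | noL]; first by exists l.
by rewrite h0 ?eqxx // => l /eqP; rewrite noL.
Qed.

Lemma set1_in_venn (T : finType) (s t : T) : ([set s] \in venn t) = (t == s).
Proof. by rewrite !inE. Qed.

Theorem mainTheorem3 (R : realFieldType) (n k : nat) (hk : (2 <= k)%N)
    (M : 'M[R]_(k, n.+1))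
    (hM01 : forall i l, 0 <= M i l <= 1)
    (hM1 : forall i, \sum_l M i l = 1)
    (* the experts' bbas under Shafer's model *)
    (mS : 'I_k -> {set 'I_n.+1} -> R)
    (hmS : forall i, is_bba set0 (mS i))
    (hmSM : forall i l, mS i [set l] = M i l)
    (hmS0 : forall i A, (forall l, A <> [set l]) -> mS i A = 0)
    (* the experts' bbas in the free-DSm model *)
    (mD : 'I_k -> hyper 'I_n.+1 -> R)
    (hmD : forall i, is_bba (hyper0 'I_n.+1) (mD i))
    (hmDM : forall i l, mD i (hyper_gen l) = M i l)
    (hmD0 : forall i A, (forall l, A <> hyper_gen l) -> mD i A = 0)
    (j : 'I_n.+1) (eps : 'rV[R]_k)
    (hj : col j M = eps^T)
    (heps : forall i, 0 < eps 0 i < 1)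
    (hzero : forall l, l != j -> exists i, M i l = 0) :
  dempster mS [set j] = 1
  /\ dsm mD (hyper_gen j) = \prod_(i < k) eps 0 i
  /\ \prod_(i < k) eps 0 i <> 0.
Proof.
have k_gt0 : (0 < k)%N by apply: leq_trans hk.
have Mj i : M i j = eps 0 i by move/matrixP/(_ i 0): hj; rewrite !mxE.
have eps_neq0 : \prod_(i < k) eps 0 i != 0.
  by apply/prodf_neq0 => i _; case/andP: (heps i) => /gt_eqF ->.
(* Assuming only a nonempty intersection lets this serve both the numerator and the denominator. *)
have mS_forced (X : {ffun 'I_k -> {set 'I_n.+1}}) : \bigcap_(i < k) X i != set0 ->
    (forall i, mS i (X i) != 0) -> forall i, X i = [set j].
  case/set0Pn=> x /bigcapP xX mX.
  have Xx i : X i = [set x].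
    have [l Xl] := mass_neq0_gen (hmS0 i) _ (mX i).
    by have := xX i isT; rewrite Xl inE => /eqP ->.
  suff <- : x = j by [].
  apply/eqP/negPn/negP => /hzero[i Mx0].
  by have := mX i; rewrite Xx hmSM Mx0 eqxx.
have cap_const (T : finType) (F : {ffun 'I_k -> {set T}}) A :
    F = [ffun=> A] -> \bigcap_(i < k) F i = A.
  move=> ->; under eq_bigr do rewrite ffunE; exact: bigcap_const_ord.
have set1j_neq0 : [set j] != set0 by apply/set0Pn; exists j; rewrite inE.
split; last split; last exact/eqP.
- have num_eq : \sum_(X : {ffun 'I_k -> {set 'I_n.+1}} | \bigcap_(i < k) X i == [set j])
      \prod_(i < k) mS i (X i) = \prod_(i < k) mS i [set j].
    apply: sum_prod_const; first by rewrite (cap_const _ _ [set j] erefl).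
    by move=> X /eqP capX; apply: mS_forced; rewrite capX.
  have den_eq : \sum_(X : {ffun 'I_k -> {set 'I_n.+1}} | \bigcap_(i < k) X i != set0)
      \prod_(i < k) mS i (X i) = \prod_(i < k) mS i [set j].
    apply: sum_prod_const; first by rewrite (cap_const _ _ [set j] erefl).
    exact: mS_forced.
  have massj : \prod_(i < k) mS i [set j] = \prod_(i < k) eps 0 i.
    by apply: eq_bigr => i _; rewrite hmSM Mj.
  rewrite /dempster (negPf set1j_neq0) num_eq.
  (* Splitting the total 1 into conflicting and non-conflicting choices turns the denominator into
     the non-conflicting mass, which is the nonzero product of the [eps 0 i]. *)
  have := sum_prod_bba hmS.
  rewrite (bigID (fun X : {ffun _} => \bigcap_(i < k) X i == set0)) /= den_eq.
  by move/eqP; rewrite eq_sym addrC -subr_eq => /eqP ->; rewrite massj divff.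
- have gen_neq0 : hyper_gen j != hyper0 'I_n.+1.
    apply/eqP => /(congr1 (fun A : hyper _ => [set j] \in hyper_val A)).
    by rewrite /= set1_in_venn eqxx inE.
  rewrite /dsm (negPf gen_neq0) (sum_prod_const mD _ (hyper_gen j)).
  + by apply: eq_bigr => i _; rewrite hmDM Mj.
  + by under eq_bigr do rewrite ffunE; rewrite bigcap_const_ord.
  + move=> X /eqP capX mX i.
    have [l Xl] := mass_neq0_gen (hmD0 i) _ (mX i).
    have : [set j] \in \bigcap_(i < k) hyper_val (X i).
      by rewrite capX set1_in_venn.
    by move/bigcapP/(_ i isT); rewrite Xl set1_in_venn => /eqP ->.
Qed.
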